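(* Let $p$ and $q$ be distinct primes and $n\ge 1$ an integer. Let $\Omega=\bigsqcup_{j=0}^{q-1}(\Omega_j\times\{j\})$, with $\Omega_j\subset\mathbb{Z}_{p^n}$, be a tile in $\mathbb{Z}_{p^n}\times\mathbb{Z}_q$. Then the following hold. (1) If $|\Omega|=p^m$ for some integer $m\ge 0$, then $\Omega_0,\Omega_1,\dots,\Omega_{q-1}$ are pairwise disjoint, and $\bigsqcup_{j=0}^{q-1}\Omega_j$ is a $p$-homogeneous subset of $\mathbb{Z}_{p^n}$. (2) If $|\Omega|=p^mq$ for some integer $m\ge 0$, then $|\Omega_i|=p^m$ for every $i\in\{0,\dots,q-1\}$, and all the sets $\Omega_i$ are $p$-homogeneous subsets of $\mathbb{Z}_{p^n}$ with a common branched level set.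
   Context: $\mathbb{Z}_N$ denotes the cyclic group $\mathbb{Z}/N\mathbb{Z}$, and $|E|$ the cardinality of $E$. A subset $\Omega$ of a finite abelian group $G$ is a tile if there is $T\subset G$ (a tiling complement; $(\Omega,T)$ is a tiling pair) such that every $g\in G$ can be written uniquely as $g=\omega+t$ with $\omega\in\Omega$, $t\in T$. $p$-homogeneous sets: for a nonempty $C\subset\mathbb{Z}_{p^n}$ and $0\le\gamma\le n$, let $C_{\bmod p^\gamma}\subset\mathbb{Z}_{p^\gamma}$ be the image of $C$ under reduction modulo $p^\gamma$. A descendant of $s\in C_{\bmod p^\gamma}$ ($0\le\gamma\le n-1$) is an element $u\in C_{\bmod p^{\gamma+1}}$ with $u\equiv s \pmod {p^\gamma}$. For $I\subset\{0,1,\dots,n-1\}$ (possibly empty), $C$ is called $p$-homogeneous with branched level set $I$ if for every $\gamma\in\{0,\dots,n-1\}$, each element of $C_{\bmod p^\gamma}$ has exactly $p$ descendants when $\gamma\in I$ and exactly one descendant when $\gamma\notin I$. $C$ is $p$-homogeneous if this holds for some $I$. *)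

(* Defs.v *)
From HB Require Import structures.
From mathcomp Require Import all_boot all_algebra.

Set Implicit Arguments.
Unset Strict Implicit.
Unset Printing Implicit Defensive.

(* Makes the product of two finZmodTypes a finZmodType. *)
HB.saturate prod.

(* The cyclic group Z/NZ for every N >= 1.  'Z_N is not used because 'Z_1 is
   Z/2Z, and the trivial group Z/p^0Z is needed below. *)
Notation Zmod N := 'I_(N.-1.+1).

Definition tiling_pair (G : finZmodType) (Om T : {set G}) : Prop :=
  forall g : G, exists! wt : G * G,
    [/\ wt.1 \in Om, wt.2 \in T & g = (wt.1 + wt.2)%R].

Definition tile (G : finZmodType) (Om : {set G}) : Prop :=
  exists T : {set G}, tiling_pair Om T.

Definition redmod (p n : nat) (C : {set Zmod (p ^ n)}) (g : nat) :
    {set Zmod (p ^ g)} :=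
  [set (inZp x : Zmod (p ^ g)) | x : Zmod (p ^ n) in C].

Definition descendants (p n : nat) (C : {set Zmod (p ^ n)}) (g : nat)
    (s : Zmod (p ^ g)) : {set Zmod (p ^ g.+1)} :=
  [set u in redmod C g.+1 | u == s %[mod p ^ g]].

Definition homogeneous_with (p n : nat) (C : {set Zmod (p ^ n)})
    (I : {set 'I_n}) : Prop :=
  C != set0 /\
  forall (g : 'I_n) (s : Zmod (p ^ g)), s \in redmod C g ->
    #|descendants C s| = if g \in I then p else 1.

Definition homogeneous (p n : nat) (C : {set Zmod (p ^ n)}) : Prop :=
  exists I : {set 'I_n}, homogeneous_with C I.

Definition layered (p n q : nat) (Om : Zmod q -> {set Zmod (p ^ n)}) :
    {set Zmod (p ^ n) * Zmod q} :=
  \bigcup_(j : Zmod q) setX (Om j) [set j].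

(* Main.v *)
Require Import Defs.
From mathcomp Require Import all_boot all_algebra.
From mathcomp Require Import all_field zify.

Set Implicit Arguments.
Unset Strict Implicit.
Unset Printing Implicit Defensive.

Import GRing.Theory Num.Theory.

(** Project the tiling pair to Z/p^n, obtaining nonnegative weights w and v
whose convolution is constant.  For every g < n the product of the Fourier
coefficients of w and v at a primitive p^(g+1)-th root of unity z vanishes, so
one of the two factors is 0; as z has degree phi(p^(g+1)) over Q, the masses of
that weight are then distributed evenly from level g to level g+1.  A weight
that is even at k levels has total mass divisible by p^k, so when w has total
mass p^m it must be even at exactly m levels, and the remaining divisibilities
force every class to have mass 0 or the least possible one: w is the indicator
of a homogeneous set.  This settles (1).  In (2), |T| is prime to q, and the
Frobenius identity T(X)^q = T(X^q) in the group algebra over F_q shows that T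
may be replaced by qT, which lies in Z/p^n x 0.  Hence all the layers tile
Z/p^n with the same complement, whose levels of evenness determine theirs. *)

(** * Masses of residue classes of a weight, and their divisibility by powers of p *)

Definition mass (N : nat) (w : 'I_N -> nat) (d r : nat) : nat :=
  \sum_(x < N | x == r %[mod d]) w x.

(* The mass of each class modulo [d] is shared equally by its [p] subclasses
   modulo [p * d]. *)
Definition balanced (p N : nat) (w : 'I_N -> nat) (d : nat) : bool :=
  [forall r : 'I_(p * d), mass w (p * d) r == mass w (p * d) (r %% d)].

Lemma mass_mod N (w : 'I_N -> nat) d r : mass w d (r %% d) = mass w d r.
Proof. by rewrite /mass; apply: eq_bigl => x; rewrite modn_mod. Qed.

Lemma eqn_mod_mul p d r x :
  (x == r %[mod p * d]) = (x == r %[mod d]) && (x %/ d == r %/ d %[mod p]).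
Proof.
have M y : y %% (p * d) %% d = y %% d by rewrite modn_dvdm // dvdn_mull.
have D y : y %/ d %% p = y %% (p * d) %/ d by rewrite modn_divl.
apply/eqP/andP => [E|[/eqP E1 /eqP E2]]; first by rewrite -M E M !D E.
rewrite (divn_eq (x %% _) d) (divn_eq (r %% _) d).
by rewrite -!D !M E1 E2.
Qed.

Lemma mass_split p N (w : 'I_N -> nat) d r : 0 < p -> 0 < d ->
  mass w d r = \sum_(i < p) mass w (p * d) (r %% d + i * d).
Proof.
move=> p0 d0; rewrite /mass.
rewrite (partition_big (fun x : 'I_N => Ordinal (ltn_pmod (x %/ d) p0)) predT) //=.
apply: eq_bigr => i _; apply: eq_bigl => x.
rewrite eqn_mod_mul addnC modnMDl modn_mod; congr andb.
rewrite divnMDl // [(r %% d) %/ d]divn_small ?ltn_pmod // addn0 -val_eqE /=.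
by rewrite (modn_small (ltn_ord i)).
Qed.

Lemma balancedP p N (w : 'I_N -> nat) d r : 0 < p -> 0 < d ->
  balanced p w d -> mass w d r = p * mass w (p * d) r.
Proof.
move=> p0 d0 /forallP H; rewrite (mass_split _ _ p0 d0).
have K s : mass w (p * d) s = mass w (p * d) (s %% d).
  have pd0 : 0 < p * d by rewrite muln_gt0 p0.
  rewrite -(mass_mod w (p * d)) (eqP (H (Ordinal (ltn_pmod s pd0)))) /=.
  by rewrite modn_dvdm ?dvdn_mull.
rewrite (eq_bigr (fun=> mass w (p * d) r)) ?sum_nat_const ?card_ord // => i _.
by rewrite K addnC modnMDl modn_mod -K.
Qed.

Lemma mass1 N (w : 'I_N -> nat) r : mass w 1 r = \sum_x w x.
Proof. by apply: eq_bigl => x; rewrite !modn1 eqxx. Qed.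

(** Exponent of p in the least possible nonzero mass of a class modulo p^g, when the weight is
    balanced at the levels of [I] and has total mass p^#|I|. *)
Definition rest n (I : {set 'I_n}) (g : nat) : nat := #|[set h in I | g <= h]|.

Lemma rest0 n (I : {set 'I_n}) : rest I 0 = #|I|.
Proof. by apply: eq_card => h; rewrite inE andbT. Qed.

Lemma rest_n n (I : {set 'I_n}) : rest I n = 0.
Proof.
by apply: eq_card0 => h; rewrite inE leqNgt ltn_ord andbF.
Qed.

Lemma restS n (I : {set 'I_n}) (g : 'I_n) : rest I g = (g \in I) + rest I g.+1.
Proof.
rewrite /rest (cardsD1 g) inE leqnn andbT; congr (_ + _).
by apply: eq_card => h; rewrite !inE ltn_neqAle -val_eqE eq_sym /= andbCA.
Qed.

(** Descending induction from [g = n]: at a level of [I] the mass is p times that of a subclass,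
    which gains one factor p; at any other level it is merely a sum of masses of subclasses. *)
Lemma dvdn_mass p N n (w : 'I_N -> nat) (I : {set 'I_n}) g r :
    0 < p -> g <= n -> (forall h : 'I_n, h \in I -> balanced p w (p ^ h)) ->
  p ^ rest I g %| mass w (p ^ g) r.
Proof.
move=> p0 + bal; have [k] := ubnP (n - g); elim: k g r => // k IH g r lt_k.
case: ltngtP => // [ltgn _|-> _]; last by rewrite rest_n dvd1n.
have {}IH s : p ^ rest I g.+1 %| mass w (p ^ g.+1) s.
  by apply: IH; lia.
have pg0 : 0 < p ^ g by rewrite expn_gt0 p0.
have /= := restS I (Ordinal ltgn); case: (boolP (_ \in I)) => [/bal bg|_] ->.
  by rewrite (balancedP _ p0 pg0 bg) expnD dvdn_mul // -expnS.
rewrite (mass_split _ _ p0 pg0) expnD mul1n.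
by apply: dvdn_sum => i _; rewrite -expnS.
Qed.

(** Ascending induction from the total mass. A balanced level divides the mass of the parent class
    by p. At a level outside [I] the mass of a subclass is a multiple of p^(rest) that is at most
    the parent mass, itself 0 or that same power, so only two values remain. *)
Lemma mass_dichotomy p N n (w : 'I_N -> nat) (I : {set 'I_n}) g r :
    0 < p -> g <= n -> (forall h : 'I_n, h \in I -> balanced p w (p ^ h)) ->
    \sum_x w x = p ^ #|I| ->
  (mass w (p ^ g) r == 0) || (mass w (p ^ g) r == p ^ rest I g).
Proof.
move=> p0 + bal tot; elim: g r => [|g IH] r lgn.
  by rewrite rest0 -tot expn0 mass1 eqxx orbT.
have dv := dvdn_mass r p0 lgn bal.
have pg0 : 0 < p ^ g by rewrite expn_gt0 p0.
have pr0 : 0 < p ^ rest I g.+1 by rewrite expn_gt0 p0.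
have le_m : mass w (p ^ g.+1) r <= mass w (p ^ g) r.
  rewrite /mass [leqLHS]big_mkcond [leqRHS]big_mkcond /= leq_sum // => x _.
  by rewrite expnS eqn_mod_mul; case: (_ == r %% p ^ g) => //=; case: ifP.
have {IH} := IH r (ltnW lgn).
have /= := restS I (Ordinal lgn) => -> /orP[/eqP E|/eqP E].
  by move: le_m; rewrite E leqn0 => ->.
move: E; case: (boolP (_ \in I)) => [/bal bg|_] E.
  move: E; rewrite (balancedP _ p0 pg0 bg) expnD -expnS => /eqP.
  by rewrite eqn_pmul2l // => ->; rewrite orbT.
move: le_m; rewrite E add0n => le_m.
case/dvdnP: dv le_m => [[|[|k]]] ->; rewrite ?mul1n ?eqxx ?orbT //.
by rewrite -[leqRHS]mul1n leq_pmul2r.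
Qed.

(** All subclasses of positive mass have the same mass, so their number is the quotient of the
    parent mass by it, which is p or 1. *)
Lemma card_heavy_children p N n (w : 'I_N -> nat) (I : {set 'I_n}) (g : 'I_n) r :
    0 < p -> (forall h : 'I_n, h \in I -> balanced p w (p ^ h)) ->
    \sum_x w x = p ^ #|I| -> 0 < mass w (p ^ g) r ->
  #|[set i : 'I_p | 0 < mass w (p ^ g.+1) (r %% p ^ g + i * p ^ g)]|
    = if g \in I then p else 1.
Proof.
move=> p0 bal tot m0.
have pg0 : 0 < p ^ g by rewrite expn_gt0 p0.
have pr0 : 0 < p ^ rest I g.+1 by rewrite expn_gt0 p0.
have /eqP Em : mass w (p ^ g) r == p ^ rest I g.
  have := mass_dichotomy r p0 (ltnW (ltn_ord g)) bal tot.
  by rewrite eqn0Ngt m0.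
move: Em; rewrite (mass_split _ _ p0 pg0) -expnS.
rewrite (eq_bigr (fun i : 'I_p =>
  (0 < mass w (p ^ g.+1) (r %% p ^ g + i * p ^ g)) * p ^ rest I g.+1)); last first.
  move=> i _; have := mass_dichotomy (r %% p ^ g + i * p ^ g) p0 (ltn_ord g) bal tot.
  by case/orP=> /eqP ->; rewrite ?pr0 ?mul1n.
rewrite -big_distrl restS expnD -sum1dep_card [X in _ -> X = _]big_mkcond /=.
move/eqP; rewrite eqn_pmul2r // => /eqP E.
transitivity (p ^ (g \in I)); last by case: (g \in I); rewrite ?expn1.
by rewrite -E; apply: eq_bigr => i _; case: ltnP.
Qed.

(** * From balanced weights on Z/p^n to homogeneous sets *)

Lemma ZmodE p g : 0 < p -> (p ^ g).-1.+1 = p ^ g.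
Proof. by move=> p0; rewrite prednK // expn_gt0 p0. Qed.

Lemma val_inZmod p g m : 0 < p -> (inZp m : Zmod (p ^ g)) = m %% p ^ g :> nat.
Proof. by move=> p0; rewrite /= ZmodE. Qed.

Lemma ltn_Zmod p g (x : Zmod (p ^ g)) : 0 < p -> x < p ^ g.
Proof. by move=> p0; rewrite -[ltnRHS]ZmodE. Qed.

Lemma mem_redmod p n (w : Zmod (p ^ n) -> nat) g (s : Zmod (p ^ g)) : 0 < p ->
  (s \in redmod [set x | 0 < w x] g) = (0 < mass w (p ^ g) s).
Proof.
move=> p0; rewrite lt0n /mass sum_nat_eq0 negb_forall; apply/imsetP/existsP.
  case=> x; rewrite inE => wx ->; exists x.
  by rewrite negb_imply -lt0n wx andbT val_inZmod // modn_mod.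
case=> x; rewrite negb_imply -lt0n => /andP[/eqP Ex wx]; exists x; rewrite ?inE //.
by apply: val_inj; rewrite [RHS]val_inZmod // Ex modn_small // ltn_Zmod.
Qed.

Lemma homogeneous_of_balanced p n (w : Zmod (p ^ n) -> nat) (I : {set 'I_n}) :
    0 < p -> (forall h : 'I_n, h \in I -> balanced p w (p ^ h)) ->
    \sum_x w x = p ^ #|I| ->
  (forall x, w x <= 1) /\ homogeneous_with [set x | 0 < w x] I.
Proof.
move=> p0 bal tot; split=> [x|].
  (* A class modulo p^n is a single point, and its only possible nonzero mass is p^0. *)
  have := mass_dichotomy x p0 (leqnn n) bal tot.
  rewrite /mass (big_pred1 x) => [|y /=]; first by rewrite rest_n => /orP[]/eqP->.
  by rewrite !modn_small ?ltn_Zmod.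
split=> [|g s].
  apply/set0Pn; have : 0 < \sum_x w x by rewrite tot expn_gt0 p0.
  rewrite lt0n sum_nat_eq0 negb_forall => /existsP[x]; rewrite -lt0n => wx.
  by exists x; rewrite inE.
rewrite mem_redmod // => ms; rewrite -(card_heavy_children p0 bal tot ms).
have pg0 : 0 < p ^ g by rewrite expn_gt0 p0.
have lt_child (i : 'I_p) : s %% p ^ g + i * p ^ g < p ^ g.+1.
  by rewrite expnS; have := ltn_pmod s pg0; have := ltn_ord i; nia.
(* The lifts of [s] modulo p^(g+1) are indexed by their base-p digit of weight p^g. *)
pose child (i : 'I_p) : Zmod (p ^ g.+1) := inZp (s %% p ^ g + i * p ^ g).
have childE i : child i = s %% p ^ g + i * p ^ g :> nat.
  by rewrite val_inZmod // modn_small.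
rewrite -(card_imset _ (_ : injective child)); last first.
  move=> i j /(congr1 (@nat_of_ord _)); rewrite !childE => /eqP.
  by rewrite eqn_add2l eqn_pmul2r // => /eqP/val_inj.
apply: eq_card => u; rewrite inE mem_redmod //.
apply/andP/imsetP => [[mu /eqP us]|[i]]; last first.
  by rewrite inE => mi ->; rewrite childE mi addnC modnMDl modn_mod eqxx.
have ltu : u %/ p ^ g < p by rewrite ltn_divLR // -expnS ltn_Zmod.
have Eu : u = child (Ordinal ltu).
  by apply: val_inj; rewrite [RHS]childE -us addnC -divn_eq.
by exists (Ordinal ltu); rewrite // inE -childE -Eu.
Qed.

(** * Vanishing sums of roots of unity and convolutions on Z/p^n *)

Section RootsOfUnity.
Local Open Scope ring_scope.

(** The minimal polynomial of [z] over Q is the cyclotomic polynomial, of size [totient n] plus one,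
    and it divides [f]. *)
Lemma size_rat_root_prim n (z : algC) (f : {poly rat}) : n.-primitive_root z ->
  root (map_poly ratr f) z -> (size f <= totient n)%N -> f = 0.
Proof.
move=> prz; have [q [mq _ dvq]] := minCpolyP z.
rewrite dvq => qf szf; apply/eqP/negPn/negP => f0.
have := dvdp_leq f0 qf; apply/negP; rewrite -ltnNge (leq_ltn_trans szf) //.
rewrite -(size_map_poly (ratr : {rmorphism rat -> algC})) -mq (minCpoly_cyclotomic prz).
by rewrite -(Cintr_Cyclotomic prz) size_map_inj_poly ?size_Cyclotomic //; apply: intr_inj.
Qed.

Lemma sum_prim_expr n k (z : algC) : (1 < n)%N -> (n %| k)%N -> n.-primitive_root z ->
  \sum_(i < k) z ^+ i = 0.
Proof.
move=> n1 nk prz; have z1 : z - 1 != 0.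
  by rewrite subr_eq0 -[z]expr1 -(prim_order_dvd prz 1) dvdn1 gtn_eqF.
apply: (mulfI z1); rewrite mulr0 -subrX1.
by apply/eqP; rewrite subr_eq0 -(prim_order_dvd prz).
Qed.

(** Cutting the range into [p] blocks of length [d] factors out the sum of the powers of z^d, a
    primitive p-th root of unity. *)
Lemma sum_periodic_prim_expr p d (z : algC) (c : nat -> algC) :
    (1 < p)%N -> (0 < d)%N -> (p * d).-primitive_root z ->
  \sum_(r < p * d) c (r %% d)%N * z ^+ r = 0.
Proof.
move=> p1 d0 prz; rewrite -(big_mkord predT (fun r => c (r %% d)%N * z ^+ r)).
rewrite big_nat_mul big_mkord.
rewrite (eq_bigr (fun i : 'I_p => (\sum_(j < d) c j * z ^+ j) * (z ^+ d) ^+ i)).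
  rewrite -mulr_sumr (sum_prim_expr p1 (dvdnn p)) ?mulr0 //.
  by have := dvdn_prim_root prz (dvdn_mulr d (dvdnn p)); rewrite mulKn // ltnW.
move=> i _; rewrite -{1}[(i * d)%N]add0n big_addn mulSn addnK big_mkord mulr_suml.
apply: eq_bigr => j _; rewrite addnC modnMDl modn_small // -mulrA; congr (_ * _).
by rewrite exprD mulrC -exprM mulnC.
Qed.

Lemma balanced_of_root p g N (w : 'I_N -> nat) (z : algC) :
    prime p -> (p ^ g.+1).-primitive_root z ->
  \sum_x (w x)%:R * z ^+ x = 0 -> balanced p w (p ^ g).
Proof.
move=> pr prz wz.
have p1 := prime_gt1 pr; have p0 := prime_gt0 pr.
have pg0 : (0 < p ^ g)%N by rewrite expn_gt0 p0.
have e0 : (0 < p ^ g.+1)%N by rewrite expn_gt0 p0.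
(* Here [t] is phi(p^(g+1)), and the exponents from [t] on form the last block of length p^g. *)
set M := mass w (p ^ g.+1)%N; set t := (p.-1 * p ^ g)%N.
have Et : (p ^ g.+1 = t + p ^ g)%N by rewrite /t expnS -{1}(prednK p0) mulSn addnC.
have wM : \sum_(r < p ^ g.+1) (M r)%:R * z ^+ r = 0.
  rewrite -[RHS]wz [RHS](partition_big (fun x : 'I_N => Ordinal (ltn_pmod x e0))
    predT) //=.
  apply: eq_bigr => r _; rewrite natr_sum mulr_suml.
  apply: eq_big => x; first by rewrite -val_eqE /= [(r %% _)%N]modn_small.
  by rewrite [(r %% _)%N]modn_small // -(prim_expr_mod prz x) => /eqP ->.
(* Subtracting from [M] the periodic weights that agree with it on the last
   block of length p^g keeps [z] a root, and lowers the degree below phi. *)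
pose a r := (M r)%:R - (M (t + r %% p ^ g)%N)%:R : rat.
have a_top r : (t <= r < p ^ g.+1)%N -> a r = 0.
  case/andP=> tr re; apply/eqP; rewrite subr_eq0; apply/eqP; congr (M _)%:R.
  rewrite -{2}(subnKC tr) /t addnC modnMDl addnC modn_small ?subnKC //.
  by rewrite ltn_subLR // -Et.
have a0 : \poly_(r < p ^ g.+1) a r = 0.
  apply: (size_rat_root_prim prz); last first.
    rewrite totient_pfactor //=; apply/leq_sizeP => r tr; rewrite coef_poly.
    by case: ifP => // re; rewrite a_top ?tr.
  apply/rootP; rewrite (@horner_coef_wide _ (p ^ g.+1)) ?size_map_poly ?size_poly //.
  pose b r := (M (t + r)%N)%:R : algC.
  rewrite (eq_bigr (fun r : 'I_(p ^ g.+1) => (M r)%:R * z ^+ r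
      - b (r %% p ^ g)%N * z ^+ r)).
    by rewrite sumrB wM expnS sum_periodic_prim_expr ?subrr // -expnS.
  by move=> r _; rewrite coef_map coef_poly ltn_ord /a /= rmorphB /= !ratr_nat mulrBl.
have aE r : (r < p ^ g.+1)%N -> M r = M (t + r %% p ^ g)%N.
  move=> re; apply/eqP; rewrite -(eqr_nat rat) -subr_eq0 -/(a r).
  by have := congr1 (fun f : {poly rat} => f`_r) a0; rewrite coef_poly re coef0 => ->.
apply/forallP => r; have re : (r < p ^ g.+1)%N by rewrite expnS.
move: (nat_of_ord r) re => {}r re; rewrite -expnS -/M.
by rewrite aE // [X in _ == X]aE ?modn_mod // (leq_ltn_trans (leq_mod _ _)).
Qed.

(** The Fourier transform turns the convolution into a product, and the transform of a constant
    vanishes at a nontrivial root of unity. *)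
Lemma balanced_or p n (w v : Zmod (p ^ n) -> nat) c g : prime p -> (g < n)%N ->
    (forall s, \sum_x w x * v (s - x)%R = c)%N ->
  balanced p w (p ^ g) || balanced p v (p ^ g).
Proof.
move=> pr gn wv; have p0 := prime_gt0 pr; have p1 := prime_gt1 pr.
have e0 : (0 < p ^ g.+1)%N by rewrite expn_gt0 p0.
have [z prz] := C_prim_root_exists e0.
have ed : (p ^ g.+1 %| p ^ n)%N by rewrite dvdn_exp2l.
have zD (x y : Zmod (p ^ n)) : z ^+ (x + y)%R = z ^+ x * z ^+ y.
  rewrite -exprD -[RHS](prim_expr_mod prz) -[LHS](prim_expr_mod prz).
  congr (z ^+ _); by rewrite /= modn_dvdm ?ZmodE.
have : (\sum_x (w x)%:R * z ^+ x) * (\sum_x (v x)%:R * z ^+ x) = 0.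
  rewrite mulr_suml (eq_bigr (fun x =>
      \sum_s (w x * v (s - x)%R)%:R * z ^+ s)); last first.
    move=> x _; rewrite mulr_sumr (reindex_inj (addIr (- x))).
    apply: eq_bigr => s _.
    have -> : z ^+ s = z ^+ x * z ^+ (s - x)%R by rewrite -zD subrKC.
    by rewrite natrM mulrACA.
  rewrite exchange_big (eq_bigr (fun s : Zmod (p ^ n) => c%:R * z ^+ s)); last first.
    by move=> s _; rewrite -mulr_suml -natr_sum wv.
  rewrite -mulr_sumr (sum_prim_expr _ _ prz) ?mulr0 ?ZmodE //.
  by rewrite -(exp1n g.+1) ltn_exp2r.
move/eqP; rewrite mulf_eq0 => /orP[]/eqP/(balanced_of_root pr prz) -> //.
by rewrite orbT.
Qed.

(** Divisibility of the two total masses bounds the number of levels in [I] by m and outside it by n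
    - m; as there are n levels, both bounds are attained. The level set depends on [v] alone, so
    weights sharing a [v] share it. The factor [d] accommodates a total mass of [v] with a part
    prime to p. *)
Lemma homogeneous_of_convolution p n m d c (w v : Zmod (p ^ n) -> nat) :
    prime p -> ~~ (p %| d)%N -> (m <= n)%N ->
    (forall s, \sum_x w x * v (s - x)%R = c)%N ->
    (\sum_x w x = p ^ m)%N -> (\sum_x v x = p ^ (n - m) * d)%N ->
  (forall x, w x <= 1)%N /\
  homogeneous_with [set x | 0 < w x]%N [set g : 'I_n | ~~ balanced p v (p ^ g)%N].
Proof.
move=> pr pd mn wv tw tv; have p0 := prime_gt0 pr.
set I := [set g : 'I_n | _].
have bw (h : 'I_n) : h \in I -> balanced p w (p ^ h)%N.
  by rewrite inE => nv; have := balanced_or pr (ltn_ord h) wv; rewrite (negbTE nv) orbF.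
have bv (h : 'I_n) : h \in ~: I -> balanced p v (p ^ h)%N by rewrite !inE negbK.
have := dvdn_mass 0 p0 (leq0n n) bw; have := dvdn_mass 0 p0 (leq0n n) bv.
rewrite !rest0 !mass1 tw tv Gauss_dvdl; last by rewrite coprimeXl // prime_coprime.
rewrite !dvdn_Pexp2l ?prime_gt1 // => leJ leI.
have := cardsC I; rewrite card_ord => cI.
apply: homogeneous_of_balanced => //; rewrite tw; congr (_ ^ _)%N.
apply/eqP; rewrite eqn_leq leI andbT -(leq_add2r #|~: I|) cI.
by rewrite -[leqRHS](subnKC mn) leq_add2l.
Qed.

(** The Frobenius identity for commuting terms of a ring that may be noncommutative, as needed for
    matrices. *)
Lemma exprp_sum (R : nzRingType) (p : nat) (J : Type) (r : seq J) (P : pred J)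
    (f : J -> R) : p \in [pchar R] -> (forall i j, GRing.comm (f i) (f j)) ->
  (\sum_(i <- r | P i) f i) ^+ p = \sum_(i <- r | P i) f i ^+ p.
Proof.
move=> chp cf; elim: r => [|i r IH].
  by rewrite !big_nil expr0n gtn_eqF // prime_gt0 // (pcharf_prime chp).
rewrite !big_cons; case: ifP => // _; rewrite -IH.
have := pFrobenius_autD_comm chp (_ : GRing.comm (f i) (\sum_(j <- r | P j) f j)).
by rewrite !pFrobenius_autE; apply; apply: commr_sum.
Qed.

End RootsOfUnity.

(** * Tilings of a finite abelian group, and dilation of the complement by a prime *)

Section Tiling.
Local Open Scope ring_scope.
Variables (G : finZmodType) (Om T : {set G}).
Hypothesis tOT : tiling_pair Om T.

Lemma tiling_count (g : G) : (\sum_(w in Om) \sum_(t in T) ((w + t)%R == g) = 1)%N.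
Proof.
have [[w t] [[/= wO tT ->] uni]] := tOT g.
rewrite pair_big_dep /= (bigD1 (w, t)) /= ?wO //= eqxx big1 // => -[w' t'] /=.
case/andP=> /andP[wO' tT'] ne; case: eqP => // E.
by case/eqP: ne; rewrite (uni (w', t')).
Qed.

Lemma tiling_card : (#|Om| * #|T| = #|G|)%N.
Proof.
rewrite -[RHS]sum1_card (eq_bigr _ (fun g _ => esym (tiling_count g))).
rewrite exchange_big /= -sum_nat_const; apply: eq_bigr => w _.
rewrite exchange_big /= -sum1_card; apply: eq_bigr => t _.
by rewrite (bigD1 (w + t)) //= eqxx big1 // => g /negbTE; rewrite eq_sym => ->.
Qed.

(** In the group algebra over F_q, let A and B be the sums over [Om] and [T], and J the sum over the
    whole group. Then AB = J and JB = |T| J, so A B^q = |T|^(q-1) J = J by Fermat. By Frobenius B^q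
    is the sum of the elements q t, so every count is 1 modulo q. *)
Lemma tiling_mulrn q : prime q -> ~~ (q %| #|T|)%N -> forall g,
  (\sum_(w in Om) \sum_(t in T) ((w + t *+ q)%R == g) = 1)%N.
Proof.
move=> prq qT.
(* The counts add up to #|G|, so it is enough that none of them vanishes. *)
suff ge1 g : (0 < \sum_(w in Om) \sum_(t in T) ((w + t *+ q)%R == g))%N.
  have le g : true -> (1 <= \sum_(w in Om) \sum_(t in T) ((w + t *+ q)%R == g) ?= iff
     (1 == \sum_(w in Om) \sum_(t in T) ((w + t *+ q)%R == g)))%N.
    by move=> _; split.
  have [_] := leqif_sum le.
  rewrite sum1_card -tiling_card exchange_big /= -sum_nat_const.
  rewrite (eq_bigr (fun w => \sum_(g : G) \sum_(t in T)
    ((w + t *+ q)%R == g)))%N => [|w wO]; last first.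
    rewrite exchange_big /= -sum1_card; apply: eq_bigr => t _.
    by rewrite (bigD1 (w + t *+ q)) //= eqxx big1 // => g /negbTE; rewrite eq_sym => ->.
  rewrite eqxx => /esym/forallP H g; exact/esym/eqP/(implyP (H g)).
(* Square matrices form a nonzero ring only in positive size, so the order is exhibited as a
   successor. *)
have [N eN] : {N | #|G| = N.+1}.
  by exists #|G|.-1; rewrite prednK //; apply/card_gt0P; exists 0.
pose f (i : 'I_N.+1) : G := enum_val (cast_ord (esym eN) i).
pose f' (h : G) : 'I_N.+1 := cast_ord eN (enum_rank h).
have fK : cancel f' f by move=> h; rewrite /f cast_ordK enum_rankK.
have f'K : cancel f f' by move=> i; rewrite /f' enum_valK cast_ordKV.
(* The regular representation of [G] over F_q. *)
pose P t : 'M['F_q]_N.+1 := \matrix_(i, j) (f i + t == f j)%:R.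
have PD s t : P s * P t = P (s + t).
  apply/matrixP => i k; rewrite !mxE (bigD1 (f' (f i + s))) //= !mxE fK eqxx mul1r.
  rewrite addrA big1 ?addr0 // => j ne; rewrite !mxE.
  case: eqP => [E|]; last by rewrite mul0r.
  by case/eqP: ne; rewrite E f'K.
have Pcomm s t : GRing.comm (P s) (P t) by rewrite /GRing.comm !PD addrC.
have PX t k : (0 < k)%N -> P t ^+ k = P (t *+ k).
  by case: k => // k _; elim: k => [|k IH]; rewrite ?expr1 // exprSr IH PD -mulrSr.
have chq : q \in [pchar 'M['F_q]_N.+1].
  by rewrite inE prq /= -scaler_nat pchar_Fp_0 // scale0r.
pose J : 'M['F_q]_N.+1 := const_mx 1.
have entry k i j : (\sum_(w in Om) \sum_(t in T) P (w + t *+ k)) i j =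
    (\sum_(w in Om) \sum_(t in T) ((w + t *+ k)%R == f j - f i)%R)%N%:R.
  rewrite summxE natr_sum; apply: eq_bigr => w _.
  rewrite summxE natr_sum; apply: eq_bigr => t _.
  by rewrite mxE addrC eq_sym -subr_eq eq_sym.
have AB k : (\sum_(w in Om) P w) * (\sum_(t in T) P (t *+ k)) =
    \sum_(w in Om) \sum_(t in T) P (w + t *+ k).
  rewrite mulr_suml; apply: eq_bigr => w _; rewrite mulr_sumr.
  by apply: eq_bigr => t _; rewrite PD.
have AB1 : (\sum_(w in Om) P w) * (\sum_(t in T) P t) = J.
  rewrite (AB 1) //; apply/matrixP => i j.
  by rewrite entry mxE tiling_count.
have JP t : J * P t = J.
  apply/matrixP => i k; rewrite !mxE (bigD1 (f' (f k - t))) //= !mxE fK subrK eqxx mulr1.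
  rewrite big1 ?addr0 // => j ne; rewrite !mxE; case: eqP => [E|]; last by rewrite mulr0.
  by case/eqP: ne; rewrite -E addrK f'K.
have JB k : J * (\sum_(t in T) P t) ^+ k = (#|T|%:R ^+ k) *: J.
  elim: k => [|k IH]; first by rewrite mulr1 scale1r.
  rewrite exprSr mulrA IH -scalerAl mulr_sumr (eq_bigr (fun=> J)) //.
  by rewrite sumr_const -scaler_nat scalerA exprSr.
have q0 := prime_gt0 prq.
have T1 : #|T|%:R ^+ q.-1 = 1 :> 'F_q.
  have T0 : #|T|%:R != 0 :> 'F_q by rewrite -(dvdn_pcharf (pchar_Fp prq)).
  have Tq := expf_card (#|T|%:R : 'F_q); rewrite card_Fp // in Tq.
  by apply: (mulfI T0); rewrite -exprS prednK // mulr1.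
have : (\sum_(w in Om) P w) * (\sum_(t in T) P t) ^+ q = J.
  have -> : (\sum_(t in T) P t) ^+ q = (\sum_(t in T) P t) * (\sum_(t in T) P t) ^+ q.-1.
    by rewrite -exprS prednK.
  by rewrite mulrA AB1 JB T1 scale1r.
rewrite (exprp_sum _ _ chq Pcomm) (eq_bigr _ (fun t _ => PX t q q0)).
(* The entry in row [0] and column [g] is the count for [g] modulo q; it equals 1, so the count is
   not 0. *)
rewrite AB => /matrixP/(_ (f' 0) (f' g)).
by rewrite entry !fK subr0 mxE; case: (\sum_(w in Om) _)%N.
Qed.
End Tiling.

(** * Counting in fibres and layers, then the theorem *)

Section Counting.
Local Open Scope ring_scope.

Lemma sum_eq_mem (H : finZmodType) (B : finType) (S : {set H}) (T : {set B})
    (h : B -> H) (g : H) :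
  (\sum_(w in S) \sum_(t in T) ((w + h t)%R == g) = \sum_(t in T) ((g - h t)%R \in S))%N.
Proof.
rewrite exchange_big; apply: eq_bigr => t _ /=; rewrite big_mkcond (bigD1 (g - h t)) //=.
rewrite subrK eqxx big1 ?addn0 => [|w]; first by case: (_ \in _).
by rewrite eq_sym subr_eq eq_sym => /negbTE ->; case: ifP.
Qed.

(** Convolution with the fibre counts of [h] becomes a sum over [T], the form in which the tiling
    counts are available. *)
Lemma sum_conv (V : finZmodType) (B : finType) (T : {set B}) (w : V -> nat)
    (h : B -> V) s :
  (\sum_x w x * \sum_(t in T) (h t == (s - x)%R) = \sum_(t in T) w (s - h t)%R)%N.
Proof.
under eq_bigr do rewrite big_distrr.
rewrite exchange_big; apply: eq_bigr => t _ /=.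
rewrite (bigD1 (s - h t)) //= subKr eqxx muln1 big1 ?addn0 // => x ne.
by case: eqP => [E|]; rewrite ?muln0 //; case/eqP: ne; rewrite E subKr.
Qed.

Lemma sum_fibers (V B : finType) (T : {set B}) (h : B -> V) :
  (\sum_x \sum_(t in T) (h t == x) = #|T|)%N.
Proof.
rewrite exchange_big -sum1_card; apply: eq_bigr => t _.
by rewrite (bigD1 (h t)) //= eqxx big1 // => x /negbTE; rewrite eq_sym => ->.
Qed.

Lemma Zmod_mulrn N (x : Zmod N) : (0 < N)%N -> x *+ N = 0.
Proof.
move=> N0; apply: val_inj; rewrite Zp_mulrn /=.
by move: (nat_of_ord x) => k; rewrite prednK // modnMl.
Qed.

Lemma mem_layered p n q (Om : Zmod q -> {set Zmod (p ^ n)}) x j :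
  ((x, j) \in layered Om) = (x \in Om j).
Proof.
apply/bigcupP/idP => [[i _]|xj]; first by rewrite !inE /= => /andP[xi /eqP ->].
by exists j; rewrite // !inE xj /=.
Qed.

Lemma card_layered p n q (Om : Zmod q -> {set Zmod (p ^ n)}) :
  #|layered Om| = (\sum_x \sum_j (x \in Om j))%N.
Proof.
rewrite pair_big -sum1_card [LHS]big_mkcond; apply: eq_bigr => -[x j] _ /=.
by rewrite mem_layered; case: (_ \in _).
Qed.

End Counting.

Theorem theorem1p1 (p q n : nat) (p_prime : prime p) (q_prime : prime q)
    (neq_pq : p <> q) (n_gt0 : 0 < n)
    (Om : Zmod q -> {set Zmod (p ^ n)})
    (Om_tile : @tile (Zmod (p ^ n) * Zmod q)%type (layered Om)) :
  ((exists m : nat, #|layered Om| = p ^ m) ->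
     (forall i j : Zmod q, i != j -> [disjoint Om i & Om j]) /\
     homogeneous (\bigcup_(j : Zmod q) Om j)) /\
  (forall m : nat, #|layered Om| = p ^ m * q ->
     (forall i : Zmod q, #|Om i| = p ^ m) /\
     (exists I : {set 'I_n}, forall i : Zmod q, homogeneous_with (Om i) I)).
Proof.
case: Om_tile => T tOT.
have p0 := prime_gt0 p_prime; have q0 := prime_gt0 q_prime.
have p_ndvd_q : ~~ (p %| q) by rewrite dvdn_prime2 //; apply/eqP.
have cardOT : (#|layered Om| * #|T| = p ^ n * q).
  by rewrite (tiling_card tOT) card_prod !card_ord ZmodE // prednK.
split=> [[m cO]|m cO].
  have mn : (m <= n).
    rewrite -(dvdn_Pexp2l _ _ (prime_gt1 p_prime)).
    rewrite -(@Gauss_dvdl _ _ q) ?coprimeXl ?prime_coprime //.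
    by rewrite -cardOT cO dvdn_mulr.
  have cT : (#|T| = p ^ (n - m) * q).
    apply/eqP; rewrite -(eqn_pmul2l (_ : 0 < p ^ m)) ?expn_gt0 ?p0 //.
    by rewrite mulnA -expnD subnKC // -cO cardOT.
  pose w x := (\sum_j (x \in Om j)).
  pose v (y : Zmod (p ^ n)) := (\sum_(t in T) (t.1 == y)).
  have wv s : (\sum_x w x * v (s - x)%R) = q.
    rewrite sum_conv /w.
    rewrite (eq_bigr (fun t => \sum_(j : Zmod q)
      (((s, j) - t)%R \in layered Om))) => [|t _].
      rewrite exchange_big /= (eq_bigr (fun=> 1)) => [|j _].
        by rewrite sum1_card card_ord prednK.
      by rewrite -(sum_eq_mem _ _ id) tiling_count.
    rewrite (reindex_inj (addIr (- t.2)%R)); apply: eq_bigr => j _.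
    by rewrite -mem_layered.
  have tw : (\sum_x w x = p ^ m) by rewrite -card_layered.
  have tv : (\sum_x v x = p ^ (n - m) * q) by rewrite sum_fibers.
  have [w1 hw] := homogeneous_of_convolution p_prime p_ndvd_q mn wv tw tv.
  split=> [i j ij|].
    (* A point common to two layers would have weight at least 2. *)
    apply/pred0P => x /=; apply/negP => /andP[xi xj].
    by have := w1 x; rewrite /w (bigD1 i) //= (bigD1 j) 1?eq_sym //= xi xj.
  exists [set g : 'I_n | ~~ balanced p v (p ^ g)].
  have -> // : \bigcup_j Om j = [set x | 0 < w x].
  apply/setP => x; rewrite inE lt0n sum_nat_eq0 negb_forall.
  apply/bigcupP/existsP => [[j _ xj]|[j]]; first by exists j; rewrite xj.
  by rewrite /= eqb0 negbK; exists j.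
have cT : (p ^ m * #|T| = p ^ n).
  by apply/eqP; rewrite -(eqn_pmul2r q0) mulnAC -cO cardOT.
have mn : (m <= n).
  by rewrite -(dvdn_Pexp2l _ _ (prime_gt1 p_prime)) -cT dvdn_mulr.
(* |T| divides p^n, so the complement may be dilated by q. *)
have q_ndvd_T : ~~ (q %| #|T|).
  apply/negP => /(dvdn_mull (p ^ m)); rewrite cT Euclid_dvdX // dvdn_prime2 //.
  by case/andP=> /eqP/esym/neq_pq.
(* The dilated complement has second coordinate 0, so it never changes layer and tiles with each
   layer separately. *)
have count s j : (\sum_(t in T) ((s - t.1 *+ q)%R \in Om j) = 1).
  rewrite -[RHS](tiling_mulrn tOT q_prime q_ndvd_T (s, j)).
  rewrite (sum_eq_mem _ _ (fun t => t *+ q)%R); apply: eq_bigr => t _.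
  have tX k : (t *+ k = (t.1 *+ k, t.2 *+ k))%R.
    by elim: k => [|k IH]; rewrite ?mulr0n // !mulrSr IH.
  have t20 : (t.2 *+ q = 0)%R by exact: Zmod_mulrn.
  have -> : ((s, j) - t *+ q = (s - t.1 *+ q, j))%R.
    by rewrite tX t20; congr pair; rewrite /= subr0.
  by rewrite mem_layered.
have card_layer j : #|Om j| = (p ^ m).
  have T0 : (0 < #|T|).
    have : (0 < p ^ m * #|T|) by rewrite cT expn_gt0 p0.
    by rewrite muln_gt0 => /andP[].
  have cG : (p ^ n = \sum_(s : Zmod (p ^ n)) 1) by rewrite sum1_card card_ord ZmodE.
  apply/eqP; rewrite -(eqn_pmul2r T0) cT [X in _ == X]cG.
  rewrite [X in _ == X](eq_bigr _ (fun s _ => esym (count s j))).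
  rewrite exchange_big mulnC -sum_nat_const; apply/eqP/eq_bigr => t _.
  rewrite -sum1_card big_mkcond (reindex_inj (addIr (- (t.1 *+ q))%R)).
  by apply: eq_bigr => s _; case: (_ \in _).
split=> //.
pose v (y : Zmod (p ^ n)) := (\sum_(t in T) ((t.1 *+ q)%R == y)).
(* This witness is built from [T] only, hence is common to all layers [j]. *)
exists [set g : 'I_n | ~~ balanced p v (p ^ g)] => j.
have tw : (\sum_x (x \in Om j) = p ^ m).
  rewrite -(card_layer j) -sum1_card [RHS]big_mkcond; apply: eq_bigr => x _.
  by case: (_ \in _).
have tv : (\sum_x v x = p ^ (n - m) * 1).
  transitivity #|T|; first exact: sum_fibers.
  apply/eqP; rewrite -(eqn_pmul2l (_ : 0 < p ^ m)) ?expn_gt0 ?p0 //.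
  by rewrite cT muln1 -expnD subnKC.
have wv s : (\sum_x (x \in Om j) * v (s - x)%R = 1).
  rewrite -[RHS](count s j); exact: sum_conv.
have p_ndvd1 : ~~ (p %| 1) by rewrite dvdn1 gtn_eqF ?prime_gt1.
have [_] := homogeneous_of_convolution p_prime p_ndvd1 mn wv tw tv.
by have -> : [set x | 0 < (x \in Om j)] = Om j by apply/setP => x; rewrite inE lt0b.
Qed.
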